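(* Let $A$ be any set. For every $F\subseteq O_A$ we have $$\mathrm{Polp}\,\mathrm{Invp}\,F=\mathrm{Loc}\,\langle F\rangle_{\mathrm S}.$$
   Context: $A$ is an arbitrary set (possibly empty, finite or infinite). $\mathbb N=\{0,1,2,\dots\}$, $n=\{0,\dots,n-1\}$ for $n\in\mathbb N$, and $A^n$ is the set of maps $n\to A$ (so $A^0=\{\emptyset\}$). $O_A^{(n)}=A^{A^n}$ is the set of $n$-ary operations, and $O_A=\biguplus_{n\in\mathbb N}O_A^{(n)}$ is the set of all finitary operations (nullary ones included); for $F\subseteq O_A$ put $F^{(n)}=F\cap O_A^{(n)}$. For $n\ge1$ and $i<n$, $e^{(n)}_i\in O_A^{(n)}$ is the $i$-th projection; $J_A$ is the set of all projections. For $f\in O_A^{(n)}$ and $g_0,\dots,g_{n-1}\in O_A^{(m)}$ the composition $f\circ(g_0,\dots,g_{n-1})\in O_A^{(m)}$ maps $x$ to $f(g_0(x),\dots,g_{n-1}(x))$; for $n=0$ it is the $m$-ary constant operation with the value of $f$. A semiclone on $A$ is a set $F\subseteq O_A$ such that for all $m,n\in\mathbb N$, $f\in F^{(n)}$ and $g_0,\dots,g_{n-1}\in(F\cup J_A)^{(m)}$ we have $f\circ(g_0,\dots,g_{n-1})\in F$. $\langle F\rangle_{\mathrm S}$ is the least semiclone containing $F$. An $m$-ary relation pair ($m\in\mathbb N$) is a pair $(\rho,\rho')$ with $\rho'\subseteq\rho\subseteq A^m$; $\mathrm{Rp}_A^{(m)}$ is the set of these, and $\mathrm{Rp}_A=\biguplus_{m\in\mathbb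 N}\mathrm{Rp}_A^{(m)}$ (disjoint union over arities). An operation $f\in O_A^{(n)}$ preserves $(\rho,\rho')\in \mathrm{Rp}_A^{(m)}$ if for all $r_0,\dots,r_{n-1}\in\rho$ the $m$-tuple $\big(f(r_0(i),\dots,r_{n-1}(i))\big)_{i<m}$ belongs to $\rho'$. For $F\subseteq O_A$, $\mathrm{Invp}F$ is the set of all relation pairs in $\mathrm{Rp}_A$ preserved by every $f\in F$. For $Q\subseteq\mathrm{Rp}_A$, $\mathrm{Polp}\,Q$ is the set of all $f\in O_A$ preserving every pair in $Q$. For $s\in\mathbb N$, $s\text{-}\mathrm{Loc}\,F=\biguplus_{n\in\mathbb N}\{g\in O_A^{(n)} : \forall B\subseteq A^n\text{ with }|B|\le s\ \exists f\in F^{(n)}:\ g|_B=f|_B\}$, and $\mathrm{Loc}\,F=\bigcap_{s\in\mathbb N}s\text{-}\mathrm{Loc}\,F$. *)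

(* Defs.v *)
From mathcomp Require Import all_boot.
From mathcomp Require Import boolp classical_sets functions cardinality.

Set Implicit Arguments.
Unset Strict Implicit.
Unset Printing Implicit Defensive.

Local Open Scope classical_set_scope.
Local Open Scope card_scope.

Definition power (A : Type) (n : nat) : Type := 'I_n -> A.

Definition op (A : Type) (n : nat) : Type := power A n -> A.

(* O_A, as the disjoint union of the sets of n-ary operations over all n,
   n = 0 included. *)
Definition finop (A : Type) : Type := {n : nat & op A n}.

Definition ops_of_arity (A : Type) (F : set (finop A)) (n : nat) : set (op A n) :=
  [set f | F (existT _ n f)].
Arguments ops_of_arity {A} F n _.

Definition proj_op (A : Type) (n : nat) (i : 'I_n) : op A n := fun x => x i.

(* J_A; there is no nullary projection since 'I_0 is empty. *)
Definition projections (A : Type) : set (finop A) :=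
  [set f | exists (n : nat) (i : 'I_n), f = existT _ n (@proj_op A n i)].

(* For n = 0 this is the m-ary constant operation with the value of f. *)
Definition compose (A : Type) (m n : nat) (f : op A n) (g : 'I_n -> op A m) :
  op A m := fun x => f (fun i => g i x).

Definition semiclone (A : Type) (F : set (finop A)) : Prop :=
  forall (m n : nat) (f : op A n) (g : 'I_n -> op A m),
    ops_of_arity F n f ->
    (forall i, ops_of_arity (F `|` @projections A) m (g i)) ->
    F (existT _ m (compose f g)).

Definition semiclone_gen (A : Type) (F : set (finop A)) : set (finop A) :=
  smallest (@semiclone A) F.

Record relpair (A : Type) (m : nat) : Type := RelPair {
  rel_fst : set (power A m);
  rel_snd : set (power A m);
  rel_snd_sub : rel_snd `<=` rel_fst }.

(* Rp_A; pairs of different arities are distinct even if both relations are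
   empty. *)
Definition finrelpair (A : Type) : Type := {m : nat & relpair A m}.

Definition preserves (A : Type) (n m : nat) (f : op A n) (p : relpair A m) :
  Prop :=
  forall r : 'I_n -> power A m, (forall j, rel_fst p (r j)) ->
    rel_snd p (fun i => f (fun j => r j i)).

Definition Invp (A : Type) (F : set (finop A)) : set (finrelpair A) :=
  [set p : finrelpair A | forall f, F f -> preserves (projT2 f) (projT2 p)].

Definition Polp (A : Type) (Q : set (finrelpair A)) : set (finop A) :=
  [set f : finop A | forall p, Q p -> preserves (projT2 f) (projT2 p)].

Definition sLoc (A : Type) (s : nat) (F : set (finop A)) : set (finop A) :=
  [set g : finop A | forall B : set (power A (projT1 g)), B #<= `I_s ->
     exists2 f : op A (projT1 g), ops_of_arity F (projT1 g) f &
       {in B, projT2 g =1 f}].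

Definition Loc (A : Type) (F : set (finop A)) : set (finop A) :=
  \bigcap_(s in [set: nat]) sLoc s F.

(* Main.v *)
(** The inclusion from right to left holds because [Polp Q] is always a
    semiclone and because preservation of an m-ary relation pair only involves
    the values of an operation at m arguments.  Conversely, let G be the
    semiclone generated by F, and list finitely many arguments b_0, ..., b_(m-1)
    in A^n.  The pair consisting of all tuples (h b_0, ..., h b_(m-1)), with h
    an n-ary member of G or a projection for the larger relation, and h in G for
    the smaller one, is preserved by G, hence by F.  Applying an n-ary operation
    g that preserves it to the n tuples given by the projections, one finds an
    h in G that agrees with g on all b_i. *)

Require Import Defs.
From mathcomp Require Import all_boot.
From mathcomp Require Import boolp classical_sets functions cardinality.

Set Implicit Arguments.
Unset Strict Implicit.
Unset Printing Implicit Defensive.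

Local Open Scope classical_set_scope.
Local Open Scope card_scope.

Lemma card_le_II_range (T : Type) (B : set T) (s : nat) :
  B #<= `I_s -> exists (m : nat) (b : 'I_m -> T), B = range b.
Proof.
move=> /pfcard_geP[->|/surjfunPex[f ->]].
  (* An empty [B] forces [m = 0], as a family over a nonempty index set has nonempty range. *)
  by exists 0, (fun i : 'I_0 => False_rect T (notF (ltn_ord i))); apply/seteqP;
    split=> // x [[]].
exists s, (fun i => f (val i)); apply/seteqP; split=> x /=.
  by move=> [k ks <-]; exists (Ordinal ks).
by move=> [i _ <-]; exists (val i) => //=.
Qed.

Lemma card_range_ord (T : Type) (m : nat) (b : 'I_m -> T) : range b #<= `I_m.
Proof.
apply: (card_le_trans (card_image_le _ _)).
by rewrite -(card_le_eql card_II) card_lexx.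
Qed.

Lemma projections_rel_fst (A : Type) (m : nat) (p : relpair A m)
    (f : finop A) (r : 'I_(projT1 f) -> power A m) :
  projections f -> (forall j, rel_fst p (r j)) ->
  rel_fst p (fun i => projT2 f (fun j => r j i)).
Proof. by move=> [n [j ef]]; subst f => pr; exact: (pr j). Qed.

(** Inner operations must only reach the larger relation: members of [Polp Q] reach even the smaller
    one, projections return a given tuple. *)
Lemma Polp_semiclone (A : Type) (Q : set (finrelpair A)) : semiclone (Polp Q).
Proof.
move=> m n f g Pf Pg p Qp r pr; apply: (Pf p Qp) => j.
have [Pgj|Jgj] := Pg j; first by apply: rel_snd_sub; exact: Pgj.
exact: projections_rel_fst Jgj pr.
Qed.

Lemma semiclone_gen_semiclone (A : Type) (F : set (finop A)) :
  semiclone (semiclone_gen F).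
Proof.
move=> m n f g Ff Fg G GP; apply: GP.1 => [|i]; first exact: Ff.
by have [Fgi|Jgi] := Fg i; [left; exact: Fgi|right].
Qed.

Lemma semiclone_gen_sub_Polp_Invp (A : Type) (F : set (finop A)) :
  semiclone_gen F `<=` Polp (Invp F).
Proof.
apply: smallest_sub; first exact: Polp_semiclone.
by move=> f Ff p; apply.
Qed.

Lemma Loc_sub_Polp (A : Type) (F : set (finop A)) (Q : set (finrelpair A)) :
  F `<=` Polp Q -> Loc F `<=` Polp Q.
Proof.
move=> FQ [n g] Lg [m p] Qp r pr.
pose b (i : 'I_m) : power A n := fun j => r j i.
have [f Ff gf] := Lg m I (range b) (card_range_ord b).
have -> : (fun i => g (b i)) = (fun i => f (b i)).
  by apply/funext => i; apply: gf; rewrite inE; exists i.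
exact: FQ Ff _ Qp r pr.
Qed.

Definition sampled (A : Type) (m n : nat) (b : 'I_m -> power A n)
    (G : set (finop A)) : set (power A m) :=
  [set t | exists2 h : op A n, ops_of_arity G n h & t = fun i => h (b i)].

Lemma sampledS (A : Type) (m n : nat) (b : 'I_m -> power A n)
    (G H : set (finop A)) : G `<=` H -> sampled b G `<=` sampled b H.
Proof. by move=> GH _ [h Gh ->]; exists h => //; exact: GH. Qed.

Definition sampled_pair (A : Type) (m n : nat) (b : 'I_m -> power A n)
    (G : set (finop A)) : relpair A m :=
  RelPair (sampledS (b := b) (@subsetUl _ G (@projections A))).

(** Tuples of the larger relation are sampled from operations [h j]; applying [f] coordinatewise
    samples [compose f h], which lies in [G]. *)
Lemma semiclone_sampled_pair (A : Type) (m n : nat) (b : 'I_m -> power A n)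
    (G : set (finop A)) :
  semiclone G -> Invp G (existT _ m (sampled_pair b G)).
Proof.
move=> scG [k f] Gf r /= pr.
have /choice[h hP] j : exists h : op A n,
    ops_of_arity (G `|` @projections A) n h /\ r j = fun i => h (b i).
  by have [h] := pr j; exists h.
exists (compose f h); first by apply: scG => // j; case: (hP j).
by apply/funext => i; congr f; apply/funext => j; have [_ ->] := hP j.
Qed.

Lemma Invp_antitone (A : Type) (F G : set (finop A)) :
  F `<=` G -> Invp G `<=` Invp F.
Proof. by move=> FG p Gp f /FG /Gp. Qed.

Theorem corollary5p6 (A : Type) (F : set (finop A)) :
  Polp (Invp F) = Loc (semiclone_gen F).
Proof.
apply/seteqP; split; last exact/Loc_sub_Polp/semiclone_gen_sub_Polp_Invp.
move=> [n g] Pg s _ B /card_le_II_range[m [b ->]].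
have /Pg : Invp F (existT _ m (sampled_pair b (semiclone_gen F))).
  apply: (@Invp_antitone _ _ (semiclone_gen F)); first exact: sub_gen_smallest.
  exact: semiclone_sampled_pair (@semiclone_gen_semiclone _ _).
(* The j-th tuple samples the j-th projection; at coordinate [i] the tuples together give back the
   argument [b i]. *)
move=> /(_ (fun j i => b i j))[j|f Ff gf].
  by exists (@proj_op A n j) => //; right; exists n, j.
exists f => // x; rewrite inE => -[i _ <-].
exact: (congr1 (fun t => t i) gf).
Qed.
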